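(* Let $X$ be a real Banach space, let $F:X\to X^*$ be a bounded pseudomonotone operator, and let $\Phi:X\rightrightarrows X$ be weakly Mosco-continuous. Assume that $\{x^k\}\subseteq X$ converges weakly to $\bar{x}\in X$, that $\bar{x}\in\Phi(\bar{x})$, and that there are sequences $\{\delta_k\},\{\varepsilon_k\}\subseteq\mathbb{R}$ converging to zero (whose terms may be negative) such that $$\langle F(x^k),y-x^k\rangle\ge \delta_k+\varepsilon_k\|y-x^k\|_X\quad\text{for all } y\in\Phi(x^k)$$ for all $k$. Then $\bar{x}$ is a solution of the QVI, i.e. $\bar{x}\in\Phi(\bar{x})$ and $\langle F(\bar{x}),d\rangle\ge 0$ for all $d\in\mathcal{T}_{\Phi(\bar{x})}(\bar{x})$.
   Context: $X^*$ is the continuous dual of $X$. Bounded operator: maps bounded sets to bounded sets. Pseudomonotone (in the sense of Brezis): an operator $T:X\to X^*$ is pseudomonotone if, for every sequence $\{x^k\}\subseteq X$ with $x^k\rightharpoonup x\in X$ and $\limsup_{k\to\infty}\langle T(x^k),x^k-x\rangle\le 0$, one has $\langle T(x),x-y\rangle\le\liminf_{k\to\infty}\langle T(x^k),x^k-y\rangle$ for all $y\in X$. Mosco convergence: subsets $S_k\subseteq X$ Mosco converge to $S\subseteq X$ if (i) for every $y\in S$ there is a sequence $y^k\in S_k$ with $y^k\to y$, and (ii) whenever $y^k\in S_k$ for all $k$ and $y$ is a weak limit point (weak limit of a subsequence) of $\{y^k\}$, then $y\in S$. Weak Mosco-continuity: $\Phi$ is weakly Mosco-continuous if, for every $x\in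 X$, $x^k\rightharpoonup x$ implies that $\Phi(x^k)$ Mosco converges to $\Phi(x)$. Tangent cone: for $z\in S$, $\mathcal{T}_S(z)=\{d: \exists\, z^k\to z,\ t_k\downarrow 0\text{ with } z^k\in S\text{ and }(z^k-z)/t_k\to d\}$. *)

(* Defs.v *)
From HB Require Import structures.
From mathcomp Require Import all_boot all_order all_algebra.
From mathcomp Require Import all_classical all_reals all_analysis.
Set Implicit Arguments.
Unset Strict Implicit.
Unset Printing Implicit Defensive.
Import Order.TTheory GRing.Theory Num.Theory.
Import numFieldNormedType.Exports.
Local Open Scope classical_set_scope.
Local Open Scope ring_scope.

Section Dual.
Context {R : realType} (X : normedModType R).

Record dual := Dual {
  dual_fun :> {linear X -> R^o};
  dual_continuous : continuous dual_fun }.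

Definition pairing (f : dual) (x : X) : R := f x.

(* The supremum is over a nonempty bounded set, see [le_dual_norm]. *)
Definition dual_norm (f : dual) : R :=
  sup [set `|pairing f x| | x in [set x : X | `|x| <= 1]].

Lemma le_dual_norm (f : dual) (x : X) : `|pairing f x| <= dual_norm f * `|x|.
Proof.
have fb := continuous_linear_bounded 0 (@dual_continuous f 0).
have [M BM] := (bounded_funP f).2 fb 1.
have ubM : has_ubound [set `|pairing f x| | x in [set x : X | `|x| <= 1]].
  by exists M => _ /= [y y1 <-]; exact: BM.
have [->|x0] := eqVneq x 0.
  by rewrite /pairing linear0 !normr0 mulr0.
have nx : 0 < `|x| by rewrite normr_gt0.
rewrite -ler_pdivrMr// mulrC.
have -> : `|x|^-1 * `|pairing f x| = `|pairing f (`|x|^-1 *: x)|.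
  by rewrite /pairing linearZ/= normrM ger0_norm// invr_ge0.
apply: ub_le_sup => //; exists (`|x|^-1 *: x) => //=.
by rewrite normrZ ger0_norm ?invr_ge0// mulVf// gt_eqF.
Qed.

End Dual.

Section VariationalNotions.
Context {R : realType} {X : normedModType R}.

Definition weakly_cvg (x : nat -> X) (l : X) :=
  forall f : dual X, pairing f (x k) @[k --> \oo] --> pairing f l.

Definition bounded_operator (T : X -> dual X) :=
  forall A : set X, bounded_set A ->
    exists M : R, forall x, A x -> dual_norm (T x) <= M.

Definition pseudomonotone (T : X -> dual X) :=
  forall (x_ : nat -> X) (x : X), weakly_cvg x_ x ->
    (limn_esup (fun k => (pairing (T (x_ k)) (x_ k - x))%:E) <= 0)%E ->
    forall y : X, ((pairing (T x) (x - y))%:E <=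
      limn_einf (fun k => (pairing (T (x_ k)) (x_ k - y))%:E))%E.

Definition mosco_cvg (S_ : nat -> set X) (S : set X) :=
  (forall y, S y ->
     exists2 y_ : nat -> X, forall k, S_ k (y_ k) & y_ k @[k --> \oo] --> y) /\
  (forall (y_ : nat -> X) (y : X), (forall k, S_ k (y_ k)) ->
     (exists2 s : nat -> nat, increasing_seq s & weakly_cvg (y_ \o s) y) ->
     S y).

Definition weakly_mosco_continuous (Phi : X -> set X) :=
  forall (x_ : nat -> X) (x : X),
    weakly_cvg x_ x -> mosco_cvg (Phi \o x_) (Phi x).

(* t_k decreasing to 0 is read as t_k > 0 and t_k --> 0; the cone is the same
   if the t_k are also required to be monotone, by passing to a subsequence. *)
Definition tangent_cone (S : set X) (z : X) : set X :=
  [set d | exists (z_ : nat -> X) (t : nat -> R),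
    [/\ forall k, S (z_ k), z_ k @[k --> \oo] --> z,
        forall k, 0 < t k, t k @[k --> \oo] --> 0 &
        (t k)^-1 *: (z_ k - z) @[k --> \oo] --> d]].

Definition QVI_solution (F : X -> dual X) (Phi : X -> set X) (x : X) :=
  Phi x x /\ forall d, tangent_cone (Phi x) x d -> 0 <= pairing (F x) d.

End VariationalNotions.

(* Main.v *)
From HB Require Import structures.
Require Import Defs.
From mathcomp Require Import all_boot all_order all_algebra.
From mathcomp Require Import lra ring.
From mathcomp Require Import all_classical all_reals all_analysis.
Import Order.TTheory GRing.Theory Num.Theory.
Import numFieldNormedType.Exports.
Local Open Scope classical_set_scope.
Local Open Scope ring_scope.

(** Let [y] be a point of [Phi xbar]. Mosco convergence provides a recovery
sequence [y_ k] in [Phi (x_ k)] with [y_ k --> y], and testing the approximate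
inequality with [y_ k] gives

  <F (x_ k), x_ k - y>
    <= <F (x_ k), y_ k - y> - delta k - eps k * `|y_ k - x_ k|.

The right-hand side tends to 0 as soon as [x_] is bounded: the values
[F (x_ k)] are then bounded in the dual, and the distances [`|y_ k - x_ k|]
stay bounded. So the limit superior of the left-hand side is at most 0 for
every [y] in [Phi xbar] ([approx_limn_esup_le0]). For [y = xbar], which is
feasible, this is the premise of pseudomonotonicity; the conclusion of
pseudomonotonicity, combined with the same bound for an arbitrary [y], is the
variational inequality [<F xbar, y - xbar> >= 0] on [Phi xbar]
([weak_limit_variational_inequality]). It passes to tangent directions by
continuity of [F xbar].

The functional-analytic input is that weakly convergent sequences are bounded
([weakly_cvg_bounded]). It rests on two classical facts.

- Every vector has a norming functional ([norming_functional]), a form of the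
  Hahn-Banach theorem. It is obtained from minimal elements: by Zorn's lemma
  there is a minimal sublinear functional below a given one, and a minimal
  sublinear functional [p] is linear, because its directional derivatives
  [dir_derive p z] are sublinear functionals below [p].

- Weakly bounded sets are bounded ([weakly_bounded_bounded]), by a gliding hump
  argument in the dual: if the set is unbounded, a series of norming
  functionals at rapidly growing points of the set, with weights [3^-n] and
  well-chosen signs, converges to a continuous functional that is unbounded on
  the set. *)

(** * Sublinear functionals and the Hahn-Banach theorem *)

Section Sublinear.
Context {R : realType} {X : lmodType R}.
Implicit Types (p q : X -> R) (x y z : X).

(** The inequality in the second clause is enough: applied to [c^-1] it gives
the converse one, see [sublinearZ]. *)
Definition sublinear p :=
  (forall x y, p (x + y) <= p x + p y) /\
  (forall (c : R) x, 0 < c -> p (c *: x) <= c * p x).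

Lemma sublinear0 p : sublinear p -> p 0 = 0.
Proof.
move=> [_ hp]; have := hp 2 0; have := hp (2^-1) 0; rewrite !scaler0.
by move=> /(_ ltac:(lra)) ? /(_ ltac:(lra)) ?; lra.
Qed.

Lemma sublinearZ p c x : sublinear p -> 0 <= c -> p (c *: x) = c * p x.
Proof.
move=> sp; rewrite le_eqVlt => /predU1P[<-|c0].
  by rewrite scale0r mul0r sublinear0.
have [_ hp] := sp; apply/eqP; rewrite eq_le hp//=.
have := hp c^-1 (c *: x); rewrite invr_gt0 => /(_ c0).
by rewrite scalerA mulVf ?gt_eqF// scale1r ler_pdivlMl.
Qed.

Lemma sublinear_ge p x : sublinear p -> - p (- x) <= p x.
Proof.
move=> sp; rewrite lerNl -subr_ge0 opprK -(sublinear0 _ sp) -[in p 0](addNr x).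
exact: sp.1.
Qed.

(** The one-sided directional derivative of [p] at [z] along [x]: by convexity
of [p] the difference quotient [(p (z + t^-1 *: x) - p z) / t^-1], which equals
[p (x + t *: z) - t * p z], is nonincreasing in [t], so that its limit as [t]
tends to infinity is an infimum. *)
Definition dir_derive p z x : R :=
  inf [set p (x + t *: z) - t * p z | t in [set t : R | 0 <= t]].

Section DirectionalDerivative.
Variables (p : X -> R) (z : X).
Hypothesis sp : sublinear p.

Lemma dir_derive_le t x :
  0 <= t -> dir_derive p z x <= p (x + t *: z) - t * p z.
Proof.
move=> t0; apply: ge_inf; last by exists t.
exists (- p (- x)) => _ [s /= s0 <-].
rewrite lerBrDr -(sublinearZ _ _ _ sp s0).
by have := sp.1 (- x) (x + s *: z); rewrite addKr; lra.
Qed.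

Lemma le_dir_derive x (m : R) :
  (forall t, 0 <= t -> m <= p (x + t *: z) - t * p z) -> m <= dir_derive p z x.
Proof.
move=> mP; apply: lb_le_inf => [|_ [t /= t0 <-]]; last exact: mP.
by exists (p (x + 0 *: z) - 0 * p z); exists 0 => /=.
Qed.

Lemma dir_derive_le_self x : dir_derive p z x <= p x.
Proof.
by have := dir_derive_le 0 x (lexx 0); rewrite scale0r addr0 mul0r subr0.
Qed.

Lemma sublinear_dir_derive : sublinear (dir_derive p z).
Proof.
split=> [x y|c x c0].
  rewrite -lerBlDr; apply: le_dir_derive => s s0; rewrite lerBlDr -lerBlDl.
  apply: le_dir_derive => t t0; rewrite lerBlDl.
  apply: le_trans (dir_derive_le (s + t) _ (addr_ge0 s0 t0)) _.
  have := sp.1 (x + s *: z) (y + t *: z).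
  by rewrite addrACA -scalerDl mulrDl; lra.
rewrite -ler_pdivrMl//; apply: le_dir_derive => t t0; rewrite ler_pdivrMl//.
apply: le_trans (dir_derive_le (c * t) _ (mulr_ge0 (ltW c0) t0)) _.
by rewrite -scalerA -scalerDr sublinearZ ?(ltW c0)// mulrBr mulrA.
Qed.

End DirectionalDerivative.

(** By minimality [p] lies below its directional derivative at [y]; the
difference quotient for [t = 1] then gives [p x <= p (x + y) - p y], the
converse of subadditivity. *)
Lemma minimal_sublinear_linear p : sublinear p ->
  (forall q, sublinear q -> (forall x, q x <= p x) -> forall x, p x <= q x) ->
  linear (p : X -> R^o).
Proof.
move=> sp pmin.
have pD x y : p (x + y) = p x + p y.
  apply/eqP; rewrite eq_le sp.1/= -lerBrDr.
  have p_le := pmin _ (sublinear_dir_derive p y sp) (dir_derive_le_self p y sp).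
  apply: le_trans (p_le x) _.
  by have := dir_derive_le _ y sp _ x ler01; rewrite scale1r mul1r.
have pN x : p (- x) = - p x.
  by apply/eqP; rewrite -addr_eq0 addrC -pD subrr sublinear0.
move=> c x y; rewrite pD; congr (_ + _).
have [c0|c0] := leP 0 c; first exact: sublinearZ.
by rewrite -[c]opprK scaleNr pN sublinearZ ?oppr_ge0 1?ltW// -mulNr.
Qed.

(** The pointwise infimum of a chain. It is finite because a sublinear [p] below
[q] satisfies [p x >= - p (- x) >= - q (- x)]; the empty chain has the lower
bound [q]. *)
Lemma sublinear_chain_inf q (C : set (X -> R)) : sublinear q ->
  (forall p, C p -> sublinear p /\ forall x, p x <= q x) ->
  total_on C (fun p p' => forall x, p' x <= p x) ->
  exists p, [/\ sublinear p, forall x, p x <= q x &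
                forall p', C p' -> forall x, p x <= p' x].
Proof.
move=> sq Cq Ctot.
have [[p0 Cp0]|C0] := pselect (exists p0, C p0); last first.
  by exists q; split => // p' Cp'; case: C0; exists p'.
pose m x := inf [set p x | p in C].
have m_le p x : C p -> m x <= p x.
  move=> Cp; apply: ge_inf; last by exists p.
  exists (- q (- x)) => _ [p' /Cq[sp' p'q] <-].
  by apply: le_trans (sublinear_ge _ _ sp'); rewrite lerN2.
have m_ge x (a : R) : (forall p, C p -> a <= p x) -> a <= m x.
  move=> aP; apply: lb_le_inf => [|_ [p Cp <-]]; last exact: aP.
  by exists (p0 x), p0.
exists m; split => [|x|p' Cp' x]; last exact: m_le.
  split=> [x y|c x c0].
    rewrite -lerBlDr; apply: (m_ge) => p Cp; rewrite lerBlDr -lerBlDl.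
    apply: (m_ge) => p' Cp'; rewrite lerBlDl.
    (* of two comparable functionals, the smaller one bounds both terms *)
    have [pp'|p'p] := Ctot _ _ Cp Cp'.
      have [sp' _] := Cq _ Cp'.
      apply: le_trans (m_le _ _ Cp') (le_trans (sp'.1 x y) _).
      by rewrite lerD2r.
    have [sp _] := Cq _ Cp.
    apply: le_trans (m_le _ _ Cp) (le_trans (sp.1 x y) _).
    by rewrite lerD2l.
  rewrite -ler_pdivrMl//; apply: (m_ge) => p Cp; rewrite ler_pdivrMl//.
  by apply: le_trans (m_le _ _ Cp) _; have [[_ ->]] := Cq _ Cp.
by apply: le_trans (m_le _ _ Cp0) _; have [_ ->] := Cq _ Cp0.
Qed.

(** Zorn's lemma for the reversed pointwise order on the sublinear functionals
below [q]: a maximal element for that order is a minimal sublinear functional,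
hence linear. *)
Lemma sublinear_dominates_linear q : sublinear q ->
  exists f : {linear X -> R^o}, forall x, f x <= q x.
Proof.
move=> sq.
pose T := {p : X -> R | sublinear p /\ forall x, p x <= q x}.
pose below (u v : T) := `[< forall x, sval v x <= sval u x >].
pose q0 : T := exist _ q (conj sq (fun x => lexx _)).
have [||A Atot|[p [sp pq]] pmin] := @ZL_preorder T q0 below.
- by move=> u; apply/asboolP.
- move=> v u w /asboolP uv /asboolP vw; apply/asboolP => x.
  exact: le_trans (vw x) (uv x).
- have [|p' p''|m [sm mq mA]] := sublinear_chain_inf q [set sval u | u in A] sq.
  + by move=> _ [u _ <-]; exact: svalP u.
  + move=> [u Au <-] [v Av <-].
    by have [/asboolP|/asboolP] := Atot _ _ Au Av; [left|right].
  + exists (exist _ m (conj sm mq)) => u Au; apply/asboolP => x /=.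
    by apply: mA; exists u.
have lp : linear (p : X -> R^o).
  apply: minimal_sublinear_linear => // p' sp' p'p.
  have p'q x : p' x <= q x by exact: le_trans (p'p x) (pq x).
  have /pmin /asboolP// :
    below (exist _ p (conj sp pq)) (exist _ p' (conj sp' p'q)).
  exact/asboolP.
pose fL := GRing.isLinear.Build R X R^o *:%R (p : X -> R^o) lp.
pose f : {linear X -> R^o} := HB.pack (p : X -> R^o) fL.
by exists f.
Qed.

End Sublinear.

Section Norming.
Context {R : realType} {X : normedModType R}.

(** A linear [f] below the directional derivative [N'] of the norm at [x] is
also below the norm. Since [N' (- x) <= - `|x|], it satisfies
[f x = - f (- x) >= `|x|]. *)
Lemma norming_functional (x : X) : exists f : {linear X -> R^o},
  (forall y, `|f y| <= `|y|) /\ f x = `|x|.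
Proof.
pose N (y : X) : R := `|y|.
have sN : sublinear N.
  by split=> [y z|c y c0]; rewrite /N ?ler_normD// normrZ gtr0_norm.
have [f fN] := sublinear_dominates_linear _ (sublinear_dir_derive N x sN).
have f_le y : f y <= `|y|.
  exact: le_trans (fN y) (dir_derive_le_self N x sN y).
exists f; split=> [y|].
  by rewrite ler_norml f_le andbT lerNl -linearN (le_trans (f_le _))// normrN.
apply/eqP; rewrite eq_le f_le/=.
have := le_trans (fN (- x)) (dir_derive_le N x sN 1 (- x) ler01).
by rewrite scale1r addNr /N normr0 mul1r linearN sub0r lerN2.
Qed.

End Norming.

(** * Uniform boundedness by a gliding hump *)

(** With [w n] the sum of the tail of [c * 3^-1 ^+ k] from [n] on, [u + w] is
nonincreasing and [u - w] is nondecreasing; they enclose [u] and have the same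
limit. *)
Lemma cvg_third_steps {R : realType} {u : nat -> R} {c : R} :
  (forall n, `|u n.+1 - u n| <= c * 3^-1 ^+ n) ->
  cvgn u /\ forall n, `|limn u - u n| <= c * (3 / 2) * 3^-1 ^+ n.
Proof.
move=> uc; have c0 : 0 <= c.
  by have := uc 0%N; rewrite expr0 mulr1; apply: le_trans.
pose w n : R := c * (3 / 2) * 3^-1 ^+ n.
have wS n : w n = c * 3^-1 ^+ n + w n.+1 by rewrite /w exprS; field.
have w0 n : 0 <= w n by rewrite mulr_ge0// mulr_ge0.
have up : nonincreasing_seq (fun n => u n + w n).
  apply/nonincreasing_seqP => n; rewrite [w n]wS.
  by have := uc n; rewrite ler_norml => /andP[]; lra.
have lo : nondecreasing_seq (fun n => u n - w n).
  apply/nondecreasing_seqP => n; rewrite [w n]wS.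
  by have := uc n; rewrite ler_norml => /andP[]; lra.
have w_cvg : w n @[n --> \oo] --> 0.
  by apply: cvg_geometric; rewrite gtr0_norm ?invf_lt1// ltr1n.
have /cvg_ex[l up_cvg] : cvgn (fun n => u n + w n).
  apply: nonincreasing_is_cvgn => //.
  exists (u 0%N - w 0%N) => _ [n _ <-].
  by apply: le_trans (lo _ _ (leq0n n)) _; have := w0 n; lra.
have u_cvg : u n @[n --> \oo] --> l.
  rewrite -[l]subr0 (_ : u = fun n => u n + w n - w n).
    exact: cvgB up_cvg w_cvg.
  by apply/funext => n; rewrite addrK.
split=> [|n]; first exact: cvgP u_cvg.
have lo_cvg : u n - w n @[n --> \oo] --> l.
  by rewrite -[l]subr0; exact: cvgB u_cvg w_cvg.
rewrite (cvg_lim _ u_cvg)//.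
have := nonincreasing_cvgn_ge up (cvgP _ up_cvg) n.
have := nondecreasing_cvgn_le lo (cvgP _ lo_cvg) n.
rewrite (cvg_lim _ lo_cvg)// (cvg_lim _ up_cvg)// => lon upn.
by rewrite -/(w n) ler_norml; apply/andP; split; lra.
Qed.

Section UniformBoundedness.
Context {R : realType} {X : normedModType R}.

(** The partial sums of a series of functionals [h m] with weights [3^-m]. The
sign of the [m]-th term is that of the preceding partial sum at [z m], so that
at this point the two add up without cancellation. *)
Fixpoint hump (h : nat -> {linear X -> R^o}) (z : nat -> X) (n : nat) :
    {linear X -> R^o} :=
  if n is m.+1 then
    hump h z m \+
      ((if 0 <= (hump h z m (z m) : R) then 1 else -1) * 3^-1 ^+ m) \*: h m
  else \0.

Section Hump.
Variables (h : nat -> {linear X -> R^o}) (z : nat -> X).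
Hypothesis h_le : forall n y, `|h n y| <= `|y|.
Hypothesis h_z : forall n, h n (z n) = `|z n|.

Let F n y : R := hump h z n y.

Let FS n y : F n.+1 y =
  F n y + (if 0 <= F n (z n) then 1 else -1) * 3^-1 ^+ n * h n y.
Proof. by []. Qed.

Lemma hump_step n y : `|F n.+1 y - F n y| <= `|y| * 3^-1 ^+ n.
Proof.
rewrite FS addrC addKr !normrM mulrC.
have -> : `|if 0 <= F n (z n) then 1 else -1 : R| = 1.
  by case: ifP => _; rewrite ?normrN normr1.
by rewrite mul1r normrX [`|3^-1|]gtr0_norm ?invr_gt0// ler_wpM2r// exprn_ge0.
Qed.

Lemma hump_large n : 3^-1 ^+ n * `|z n| <= `|F n.+1 (z n)|.
Proof.
rewrite FS h_z; have : 0 <= 3^-1 ^+ n * `|z n| :> R by rewrite mulr_ge0.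
rewrite -mulrA; move: (3^-1 ^+ n * _) => a a0.
case: ifP => Fz; rewrite ?mulN1r ?mul1r ler_normr; apply/orP;
  by [left; lra|right; lra].
Qed.

(** At [z n] the [n]-th term contributes at least [3^-n * `|z n|], and the later
terms alter the value by at most half of that, the sum of [3^-k] over [k > n]
being [3^-n / 2]. *)
Lemma hump_limit : exists f : dual X,
  forall n, 3^-1 ^+ n * `|z n| / 2 <= `|pairing f (z n)|.
Proof.
have Fcvg y := (cvg_third_steps (hump_step ^~ y)).1.
have Flim y := (cvg_third_steps (hump_step ^~ y)).2.
pose g (y : X) : R^o := limn (F ^~ y).
have gL : linear g.
  move=> c x y; apply: cvg_lim => //.
  rewrite (_ : F ^~ _ = fun n => c * F n x + F n y).
    by apply: cvgD (Fcvg y); exact: cvgMl_tmp (Fcvg x).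
  by apply/funext => n; rewrite /F linearP.
pose gHB := GRing.isLinear.Build R X R^o *:%R g gL.
pose f : {linear X -> R^o} := HB.pack g gHB.
have f_cont : continuous f.
  apply: bounded_linear_continuous; apply/linear_boundedP.
  exists (3 / 2); split; first exact: num_real.
  move=> M M32 y; have := Flim y 0%N.
  rewrite /F/= subr0 expr0 mulr1 => /le_trans; apply.
  by rewrite mulrC ler_wpM2r// ltW.
exists (Dual f_cont) => n.
have := hump_large n; have := Flim (z n) n.+1.
rewrite -/(g (z n)) exprS /pairing/= -/(F n.+1 (z n)) => gF Fz.
have := ler_normD (F n.+1 (z n) - g (z n)) (g (z n)); rewrite subrK.
by move: gF; rewrite distrC; lra.
Qed.

End Hump.

(** If [A] is unbounded, it has points [z n] of norm above [2 * n * 3 ^ n]; the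
limit of the humps of their norming functionals is at least [n] in absolute
value at [z n]. *)
Lemma weakly_bounded_bounded (A : set X) :
  (forall f : dual X, exists M : R, forall x, A x -> `|pairing f x| <= M) ->
  bounded_set A.
Proof.
move=> A_weak; have [[M AM]|A_unb] :=
    pselect (exists M : R, forall x, A x -> `|x| <= M).
  exists M; split; first exact: num_real.
  by move=> N MN x /AM /le_trans; apply; exact: ltW.
have /choice[z zP] (n : nat) : exists x, A x /\ n%:R * 2 * 3 ^+ n < `|x|.
  apply: contrapT => noz; apply: A_unb; exists (n%:R * 2 * 3 ^+ n) => x Ax.
  by rewrite leNgt; apply/negP => x_big; apply: noz; exists x.
have /choice[h hP] n := norming_functional (z n).
have [f fz] := hump_limit h z (fun n => (hP n).1) (fun n => (hP n).2).
have [M fM] := A_weak f.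
pose n := (Num.truncn M).+1.
have := le_trans (fz n) (fM _ (zP n).1).
have n_le : n%:R <= 3^-1 ^+ n * `|z n| / 2.
  rewrite ler_pdivlMr// mulrC exprVn ler_pdivlMl ?exprn_gt0//.
  by have := ltW (zP n).2; lra.
move=> /(le_trans n_le).
by rewrite leNgt truncnS_gt.
Qed.

Lemma weakly_cvg_bounded (x_ : nat -> X) (x : X) :
  weakly_cvg x_ x -> bounded_set (range x_).
Proof.
move=> x_cvg; apply: weakly_bounded_bounded => f.
have [M [_ fM]] := cvg_seq_bounded (cvgP _ (x_cvg f)).
exists (M + 1) => _ [k _ <-].
by apply: (fM (M + 1)); rewrite ?ltrDl.
Qed.

End UniformBoundedness.

(** * Weak limits of approximate solutions *)

Lemma limn_esup_le0 {R : realType} {u c : nat -> R} :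
  c k @[k --> \oo] --> 0 -> (forall k, u k <= c k) ->
  (limn_esup (fun k => (u k)%:E) <= 0)%E.
Proof.
move=> c0 uc; apply/lee_addgt0Pr => e e0; rewrite add0e.
apply: ereal_inf_le.
exists (ereal_sup [set (u k)%:E | k in [set k | c k <= e]]).
  by exists [set k | c k <= e] => //; exact: cvgr_le c0 _ e0.
by apply: ge_ereal_sup => _ [k /= ck <-]; rewrite lee_fin (le_trans (uc k)).
Qed.

Section ApproximateSolutions.
Context {R : realType} {X : normedModType R}.
Variables (F : X -> dual X) (Phi : X -> set X) (x_ : nat -> X) (x : X).
Variables (delta eps : nat -> R).
Hypothesis F_bounded : bounded_operator F.
Hypothesis Phi_mosco : weakly_mosco_continuous Phi.
Hypothesis x_cvg : weakly_cvg x_ x.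
Hypothesis delta_cvg : delta k @[k --> \oo] --> 0.
Hypothesis eps_cvg : eps k @[k --> \oo] --> 0.
Hypothesis x_approx : forall k y, Phi (x_ k) y ->
  delta k + eps k * `|y - x_ k| <= pairing (F (x_ k)) (y - x_ k).

(** The sequence [c] below collects the three errors: that of replacing [y] by
the recovery sequence [y_], controlled by the bound [M] on the norms of
[F (x_ k)], and the two perturbations [delta] and [eps], the latter multiplied
by a bound on [`|y_ k - x_ k|]. *)
Lemma approx_limn_esup_le0 (y : X) : Phi x y ->
  (limn_esup (fun k => (pairing (F (x_ k)) (x_ k - y))%:E) <= 0)%E.
Proof.
move=> Phiy; have x_bnd := weakly_cvg_bounded _ _ x_cvg.
have [M FM] := F_bounded _ x_bnd.
have [B [_ xB]] := x_bnd.
have {}xB k : `|x_ k| <= B + 1 by apply: (xB (B + 1)); [rewrite ltrDl|exists k].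
have [y_ Phiy_ y_cvg] := (Phi_mosco _ _ x_cvg).1 y Phiy.
have dist_cvg : `|y_ k - y| @[k --> \oo] --> (0 : R).
  by apply/norm_cvg0P/subr_cvg0.
pose c k : R := M * `|y_ k - y| - delta k
  + `|eps k| * (`|y_ k - y| + (B + 1 + `|y|)).
have c_cvg : c k @[k --> \oo] --> 0.
  have <- : M * 0 - 0 + `|0 : R| * (0 + (B + 1 + `|y|)) = 0.
    by rewrite normr0 mulr0 mul0r subr0 addr0.
  apply: cvgD; first exact: cvgB (cvgMl_tmp dist_cvg) delta_cvg.
  exact: cvgM (cvg_norm eps_cvg) (cvgD dist_cvg (cvg_cst _)).
apply: (limn_esup_le0 c_cvg) => k.
have Fy : pairing (F (x_ k)) (y_ k - y) <= M * `|y_ k - y|.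
  apply: le_trans (ler_norm _) (le_trans (le_dual_norm _ _) _).
  by rewrite ler_wpM2r// FM//; exists k.
have yx : `|y_ k - x_ k| <= `|y_ k - y| + (B + 1 + `|y|).
  rewrite -(subrKA y) (le_trans (ler_normD _ _))// lerD2l.
  by rewrite (le_trans (ler_normB _ _))// addrC lerD2r.
have eps_yx : - (eps k * `|y_ k - x_ k|) <=
    `|eps k| * (`|y_ k - y| + (B + 1 + `|y|)).
  rewrite -mulNr; apply: le_trans (ler_wpM2l (normr_ge0 _) yx).
  by rewrite ler_wpM2r// -normrN ler_norm.
have := x_approx _ _ (Phiy_ k); move: Fy; rewrite /pairing !linearB/= /c.
lra.
Qed.

(** Pseudomonotonicity may be used because the limit superior is controlled at
[y = x] itself; its conclusion bounds [<F x, x - y>] by a limit inferior that is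
at most the limit superior controlled at [y]. *)
Lemma weak_limit_variational_inequality :
  pseudomonotone F -> Phi x x ->
  forall y, Phi x y -> 0 <= pairing (F x) (y - x).
Proof.
move=> F_pseudo Phix y Phiy.
have := F_pseudo _ _ x_cvg (approx_limn_esup_le0 _ Phix) y.
move=> /le_trans/(_ (limn_einf_sup _)).
move=> /le_trans/(_ (approx_limn_esup_le0 _ Phiy)).
by rewrite lee_fin -(opprB y) /pairing linearN oppr_le0.
Qed.

End ApproximateSolutions.

Lemma variational_inequality_tangent_cone {R : realType} {X : normedModType R}
    (f : dual X) (S : set X) (x d : X) :
  (forall y, S y -> 0 <= pairing f (y - x)) ->
  tangent_cone S x d -> 0 <= pairing f d.
Proof.
move=> f_ge0 [z_ [t [Sz _ t0 _ d_cvg]]].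
have fd : pairing f ((t k)^-1 *: (z_ k - x)) @[k --> \oo] --> pairing f d.
  by apply: cvg_comp d_cvg _; exact: dual_continuous.
apply: (cvgr_to_ge fd); apply: nearW => k.
rewrite /pairing linearZ; apply: mulr_ge0; last exact: f_ge0.
by rewrite invr_ge0 ltW.
Qed.

Theorem proposition2p7 (R : realType) (X : completeNormedModType R)
  (F : X -> dual X) (Phi : X -> set X)
  (F_bounded : bounded_operator F)
  (F_pseudomonotone : pseudomonotone F)
  (Phi_mosco : weakly_mosco_continuous Phi)
  (x_ : nat -> X) (xbar : X)
  (x_cvg : weakly_cvg x_ xbar)
  (xbar_feasible : Phi xbar xbar)
  (delta eps : nat -> R)
  (delta_cvg : delta k @[k --> \oo] --> (0 : R))
  (eps_cvg : eps k @[k --> \oo] --> (0 : R))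
  (x_approx : forall (k : nat) (y : X), Phi (x_ k) y ->
     delta k + eps k * `|y - x_ k| <= pairing (F (x_ k)) (y - x_ k)) :
  QVI_solution F Phi xbar.
Proof.
split=> // d; apply: variational_inequality_tangent_cone => y Phiy.
by apply: weak_limit_variational_inequality x_approx _ _ _ _.
Qed.
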